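(* Let $R$ be a commutative ring with $1$, let $E$ be a row-finite directed graph, and let $F$ be the directed graph obtained from $E$ by adding infinite heads to sources. Then there is a surjective Morita context between the Leavitt path algebras $L_R(F)$ and $L_R(E)$.
   Context: A directed graph $E=(E^0,E^1,r,s)$ consists of countable sets of vertices and edges with range and source maps $r,s:E^1\to E^0$. Convention (that of the path category of $E$ viewed as a $1$-graph): $ef$ is a path if $s(e)=r(f)$. $E$ is row-finite if $r^{-1}(v)$ is finite for every $v\in E^0$; a source is a vertex $v$ with $r^{-1}(v)=\emptyset$. Adding an infinite head to a source $v$ means adjoining new vertices $v_1,v_2,\dots$ and new edges $f_1,f_2,\dots$ with $r(f_i)=v_{i-1}$ and $s(f_i)=v_i$ (where $v_0=v$); $F$ is obtained by doing this at every source of $E$. $L_R(E)$ is the universal (not necessarily unital) $R$-algebra generated by a Leavitt $E$-family, i.e. elements $P_v$ ($v\in E^0$), $S_e,S_{e^*}$ ($e\in E^1$) such that $P_vP_w=\delta_{v,w}P_v$; $P_{r(e)}S_e=S_e=S_eP_{s(e)}$ and $P_{s(e)}S_{e^*}=S_{e^*}=S_{e^*}P_{r(e)}$; $S_{e^*}S_f=\delta_{e,f}P_{s(e)}$; and $P_v=\sum_{r(e)=v}S_eS_{e^*}$ whenever $r^{-1}(v)$ is finite and nonempty. Morita context between rings $A$ and $B$ (not necessarily unital): an $A$--$B$ bimodule $M$, a $B$--$A$ bimodule $N$, and bimodule homomorphisms $\psi:M\otimes_BN\to A$, $\phi:N\otimes_AM\to B$ satisfying $n'\cdot\psi(m\otimes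 n)=\phi(n'\otimes m)\cdot n$ and $m'\cdot\phi(n\otimes m)=\psi(m'\otimes n)\cdot m$ for all $m,m'\in M$, $n,n'\in N$; it is surjective if $\psi$ and $\phi$ are surjective. *)

(* Defs.v *)
From HB Require Import structures.
From mathcomp Require Import all_boot all_order all_algebra.
From mathcomp Require Import finmap.
From mathcomp Require Import mathcomp_extra boolp classical_sets functions.
From mathcomp Require Import cardinality fsbigop.

Set Implicit Arguments.
Unset Strict Implicit.
Unset Printing Implicit Defensive.

Import GRing.Theory.
Local Open Scope ring_scope.
Local Open Scope classical_set_scope.
Local Open Scope quotient_scope.

Declare Scope rng_scope.
Delimit Scope rng_scope with rng.
Local Open Scope rng_scope.

Reserved Notation "x ** y" (at level 40, left associativity).
Reserved Notation "a *> m" (at level 40, left associativity).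
Reserved Notation "m <* b" (at level 40, left associativity).
Reserved Notation "M ⊗ N" (at level 40, left associativity).
Reserved Notation "m ⊗ₜ n" (at level 40, no associativity).

(******************************************************************************)
(* Rings and algebras without unit, and bimodules over them.                  *)
(*      rngType == associative rings, not necessarily unital                  *)
(* rngAlgType R == associative R-algebras, not necessarily unital             *)
(* bimodType A B == A-B-bimodules (additive groups), A and B being rngTypes   *)
(*       x ** y == product in a rngType                                       *)
(*       a *> m == left action on a bimodule                                  *)
(*       m <* b == right action on a bimodule                                 *)
(******************************************************************************)

HB.mixin Record Zmodule_isRng A of GRing.Zmodule A := {
  rmul : A -> A -> A;
  rmulA : associative rmul;
  rmulDl : left_distributive rmul +%R;
  rmulDr : right_distributive rmul +%R
}.

#[short(type="rngType")]
HB.structure Definition Rng := {A of GRing.Zmodule A & Zmodule_isRng A}.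

Notation "x ** y" := (rmul x y) : rng_scope.

HB.mixin Record Rng_isRngAlg (R : pzRingType) A
    of GRing.Lmodule R A & Rng A := {
  rscalerAl : forall (k : R) (x y : A), k *: (rmul x y) = rmul (k *: x) y;
  rscalerAr : forall (k : R) (x y : A), k *: (rmul x y) = rmul x (k *: y)
}.

#[short(type="rngAlgType")]
HB.structure Definition RngAlg (R : pzRingType) :=
  {A of GRing.Lmodule R A & Rng A & Rng_isRngAlg R A}.

HB.mixin Record Zmodule_isBimodule (A B : rngType) M of GRing.Zmodule M := {
  lact : A -> M -> M;
  ract : M -> B -> M;
  lactA : forall a a' m, lact a (lact a' m) = lact (rmul a a') m;
  lactDl : forall a a' m, lact (a + a') m = lact a m + lact a' m;
  lactDr : forall a m m', lact a (m + m') = lact a m + lact a m';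
  ractA : forall m b b', ract (ract m b) b' = ract m (rmul b b');
  ractDl : forall m m' b, ract (m + m') b = ract m b + ract m' b;
  ractDr : forall m b b', ract m (b + b') = ract m b + ract m b';
  lractA : forall a m b, ract (lact a m) b = lact a (ract m b)
}.

#[short(type="bimodType")]
HB.structure Definition Bimodule (A B : rngType) :=
  {M of GRing.Zmodule M & Zmodule_isBimodule A B M}.

Arguments lact {A B s} : rename.
Arguments ract {A B s} : rename.
Notation "a *> m" := (lact a m) : rng_scope.
Notation "m <* b" := (ract m b) : rng_scope.

Definition bimod_hom (A B : rngType) (U V : bimodType A B) (f : U -> V) : Prop :=
  [/\ forall u v, f (u + v) = f u + f v,
      forall a u, f (a *> u) = a *> f u
    & forall u b, f (u <* b) = f u <* b].

Definition regular (A : rngType) : Type := A.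
HB.instance Definition _ (A : rngType) := GRing.Zmodule.on (regular A).
HB.instance Definition _ (A : rngType) :=
  Zmodule_isBimodule.Build A A (regular A)
    (@rmulA A) (@rmulDl A) (@rmulDr A)
    (fun m b b' => esym (@rmulA A m b b')) (@rmulDl A) (@rmulDr A)
    (fun a m b => esym (@rmulA A a m b)).

(******************************************************************************)
(* Tensor product of bimodules: formal expressions in the symbols m (x) n,    *)
(* modulo the least congruence that satisfies the additive group laws, is     *)
(* biadditive and B-balanced.  The universal property is tensor_lift.         *)
(******************************************************************************)

Inductive tensor_term (M N : Type) : Type :=
| TTzero
| TTadd of tensor_term M N & tensor_term M N
| TTopp of tensor_term M N
| TTpure of M & N.
Arguments TTzero {M N}.

HB.instance Definition _ (M N : Type) := gen_eqMixin (tensor_term M N).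
HB.instance Definition _ (M N : Type) := gen_choiceMixin (tensor_term M N).

Section TensorProduct.
Context (A B C : rngType) (M : bimodType A B) (N : bimodType B C).
Implicit Types (t u : tensor_term M N) (a : A) (b : B) (c : C) (m : M) (n : N).

Inductive tensor_eq : tensor_term M N -> tensor_term M N -> Prop :=
| TErefl t : tensor_eq t t
| TEsym t u : tensor_eq t u -> tensor_eq u t
| TEtrans t u v : tensor_eq t u -> tensor_eq u v -> tensor_eq t v
| TEadd t t' u u' :
    tensor_eq t t' -> tensor_eq u u' -> tensor_eq (TTadd t u) (TTadd t' u')
| TEopp t t' : tensor_eq t t' -> tensor_eq (TTopp t) (TTopp t')
| TEaddA t u v : tensor_eq (TTadd t (TTadd u v)) (TTadd (TTadd t u) v)
| TEaddC t u : tensor_eq (TTadd t u) (TTadd u t)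
| TEadd0 t : tensor_eq (TTadd TTzero t) t
| TEaddN t : tensor_eq (TTadd (TTopp t) t) TTzero
| TEpureDl m m' n :
    tensor_eq (TTpure (m + m') n) (TTadd (TTpure m n) (TTpure m' n))
| TEpureDr m n n' :
    tensor_eq (TTpure m (n + n')) (TTadd (TTpure m n) (TTpure m n'))
| TEbal m b n : tensor_eq (TTpure (m <* b) n) (TTpure m (b *> n)).

Definition tensor_rel : rel (tensor_term M N) :=
  [rel t u | `[< tensor_eq t u >]].

Fact tensor_rel_refl : reflexive tensor_rel.
Proof. by move=> t; apply/asboolP/TErefl. Qed.
Fact tensor_rel_sym : symmetric tensor_rel.
Proof. by move=> t u; apply/asboolP/asboolP; apply: TEsym. Qed.
Fact tensor_rel_trans : transitive tensor_rel.
Proof. by move=> u t v /asboolP tu /asboolP uv; apply/asboolP/(TEtrans tu). Qed.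

Definition tensor_equiv :=
  EquivRel tensor_rel tensor_rel_refl tensor_rel_sym tensor_rel_trans.

Definition tensor : Type := {eq_quot tensor_equiv}.
HB.instance Definition _ := Choice.on tensor.
HB.instance Definition _ := EqQuotient.on tensor.

Definition tclass t : tensor := \pi_{eq_quot tensor_equiv} t.

Lemma tclassP t u : tclass t = tclass u <-> tensor_eq t u.
Proof. by split=> [/eqmodP/asboolP | h]; last by apply/eqmodP/asboolP. Qed.

Lemma tclassW (P : tensor -> Prop) : (forall t, P (tclass t)) -> forall x, P x.
Proof. by move=> h x; rewrite -[x]reprK; apply: h. Qed.

Lemma trepr_eq t : tensor_eq (repr (tclass t)) t.
Proof. by apply/tclassP; rewrite /tclass reprK. Qed.

Definition tadd (x y : tensor) : tensor := tclass (TTadd (repr x) (repr y)).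
Definition topp (x : tensor) : tensor := tclass (TTopp (repr x)).

Lemma taddE t u : tadd (tclass t) (tclass u) = tclass (TTadd t u).
Proof. by apply/tclassP/TEadd; apply: trepr_eq. Qed.
Lemma toppE t : topp (tclass t) = tclass (TTopp t).
Proof. by apply/tclassP/TEopp; apply: trepr_eq. Qed.

Fact taddA : associative tadd.
Proof.
move=> x; elim/tclassW: x => t x; elim/tclassW: x => u x; elim/tclassW: x => v;
  rewrite !taddE.
exact/tclassP/TEaddA.
Qed.
Fact taddC : commutative tadd.
Proof.
by move=> x; elim/tclassW: x => t x; elim/tclassW: x => u;
  rewrite !taddE; apply/tclassP/TEaddC.
Qed.
Fact tadd0 : left_id (tclass TTzero) tadd.
Proof. by move=> x; elim/tclassW: x => t;
  rewrite taddE; apply/tclassP/TEadd0. Qed.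
Fact taddN : left_inverse (tclass TTzero) topp tadd.
Proof. by move=> x; elim/tclassW: x => t;
  rewrite toppE taddE; apply/tclassP/TEaddN. Qed.

HB.instance Definition _ := GRing.isZmodule.Build tensor taddA taddC tadd0 taddN.

Definition pure (m : M) (n : N) : tensor := tclass (TTpure m n).

Lemma tclassD t u : tclass (TTadd t u) = tclass t + tclass u.
Proof. exact: esym (taddE t u). Qed.
Lemma tclassN t : tclass (TTopp t) = - tclass t.
Proof. exact: esym (toppE t). Qed.

Fixpoint tmap (f : M -> M) (g : N -> N) (t : tensor_term M N) : tensor_term M N :=
  match t with
  | TTzero => TTzero
  | TTadd u v => TTadd (tmap f g u) (tmap f g v)
  | TTopp u => TTopp (tmap f g u)
  | TTpure m n => TTpure (f m) (g n)
  end.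

Lemma tmap_eq (f : M -> M) (g : N -> N) :
  {morph f : x y / x + y} -> (forall m b, f (m <* b) = f m <* b) ->
  {morph g : x y / x + y} -> (forall b n, g (b *> n) = b *> g n) ->
  forall t u, tensor_eq t u -> tensor_eq (tmap f g t) (tmap f g u).
Proof.
move=> fD fZ gD gZ t u; elim=> {t u} /=; try by constructor.
- by move=> t u v _ h _; apply: TEtrans.
- by move=> m m' n; rewrite fD; apply: TEpureDl.
- by move=> m n n'; rewrite gD; apply: TEpureDr.
- by move=> m b n; rewrite fZ gZ; apply: TEbal.
Qed.

Definition tlact (a : A) (x : tensor) : tensor :=
  tclass (tmap (lact a) id (repr x)).
Definition tract (x : tensor) (c : C) : tensor :=
  tclass (tmap id (fun n => n <* c) (repr x)).

Lemma tlactE a t : tlact a (tclass t) = tclass (tmap (lact a) id t).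
Proof.
apply/tclassP/tmap_eq => //; last exact: trepr_eq.
- by move=> x y; apply: lactDr.
- by move=> m b; rewrite lractA.
Qed.
Lemma tractE c t : tract (tclass t) c = tclass (tmap id (fun n => n <* c) t).
Proof.
apply/tclassP/tmap_eq => //; last exact: trepr_eq.
- by move=> x y; apply: ractDl.
- by move=> b n; rewrite lractA.
Qed.

Fact tlactA a a' x : tlact a (tlact a' x) = tlact (a ** a') x.
Proof.
elim/tclassW: x => t; rewrite !tlactE; congr tclass.
by elim: t => //= [t -> u -> | t -> | m n] //; rewrite lactA.
Qed.
Fact tlactDl a a' x : tlact (a + a') x = tlact a x + tlact a' x.
Proof.
elim/tclassW: x => t; rewrite !tlactE.
elim: t => [|t IHt u IHu|t IHt|m n] /=.
- exact: esym (addr0 _).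
- by rewrite !tclassD IHt IHu addrACA.
- by rewrite !tclassN IHt opprD.
- by rewrite lactDl -tclassD; apply/tclassP/TEpureDl.
Qed.
Fact tlactDr a x y : tlact a (x + y) = tlact a x + tlact a y.
Proof.
elim/tclassW: x => t; elim/tclassW: y => u.
by rewrite -tclassD !tlactE /= tclassD.
Qed.
Fact tractA x c c' : tract (tract x c) c' = tract x (c ** c').
Proof.
elim/tclassW: x => t; rewrite !tractE; congr tclass.
by elim: t => //= [t -> u -> | t -> | m n] //; rewrite ractA.
Qed.
Fact tractDl x y c : tract (x + y) c = tract x c + tract y c.
Proof.
elim/tclassW: x => t; elim/tclassW: y => u.
by rewrite -tclassD !tractE /= tclassD.
Qed.
Fact tractDr x c c' : tract x (c + c') = tract x c + tract x c'.
Proof.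
elim/tclassW: x => t; rewrite !tractE.
elim: t => [|t IHt u IHu|t IHt|m n] /=.
- exact: esym (addr0 _).
- by rewrite !tclassD IHt IHu addrACA.
- by rewrite !tclassN IHt opprD.
- by rewrite ractDr -tclassD; apply/tclassP/TEpureDr.
Qed.
Fact tlractA a x c : tract (tlact a x) c = tlact a (tract x c).
Proof.
elim/tclassW: x => t; rewrite tlactE !tractE tlactE; congr tclass.
by elim: t => //= [t -> u -> | t ->].
Qed.

HB.instance Definition _ := Zmodule_isBimodule.Build A C tensor
  tlactA tlactDl tlactDr tractA tractDl tractDr tlractA.

End TensorProduct.

Notation "M ⊗ N" := (@tensor _ _ _ M N) : rng_scope.
Notation "m ⊗ₜ n" := (pure m n) : rng_scope.

Section TensorTheory.
Context (A B C : rngType) (M : bimodType A B) (N : bimodType B C).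

Lemma pureDl (m m' : M) (n : N) : (m + m') ⊗ₜ n = m ⊗ₜ n + m' ⊗ₜ n.
Proof. by rewrite -tclassD; apply/tclassP/TEpureDl. Qed.
Lemma pureDr (m : M) (n n' : N) : m ⊗ₜ (n + n') = m ⊗ₜ n + m ⊗ₜ n'.
Proof. by rewrite -tclassD; apply/tclassP/TEpureDr. Qed.
Lemma pure_bal (m : M) (b : B) (n : N) : (m <* b) ⊗ₜ n = m ⊗ₜ (b *> n).
Proof. exact/tclassP/TEbal. Qed.
Lemma lact_pure (a : A) (m : M) (n : N) : a *> (m ⊗ₜ n) = (a *> m) ⊗ₜ n.
Proof. exact: tlactE. Qed.
Lemma ract_pure (m : M) (n : N) (c : C) : (m ⊗ₜ n) <* c = m ⊗ₜ (n <* c).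
Proof. exact: tractE. Qed.

Lemma tensor_ind (P : M ⊗ N -> Prop) :
  P 0 -> (forall x y, P x -> P y -> P (x + y)) ->
  (forall x, P x -> P (- x)) -> (forall m n, P (m ⊗ₜ n)) -> forall x, P x.
Proof.
move=> P0 PD PN Pp x; elim/tclassW: x; elim=> [|t IHt u IHu|t IHt|m n] //.
- by rewrite tclassD; apply: PD.
- by rewrite tclassN; apply: PN.
- exact: Pp.
Qed.

Lemma tensor_lift (V : zmodType) (f : M -> N -> V) :
  (forall m m' n, f (m + m') n = f m n + f m' n) ->
  (forall m n n', f m (n + n') = f m n + f m n') ->
  (forall m b n, f (m <* b) n = f m (b *> n)) ->
  exists! g : M ⊗ N -> V,
    (forall x y, g (x + y) = g x + g y) /\ (forall m n, g (m ⊗ₜ n) = f m n).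
Proof.
move=> fDl fDr fB.
pose ev := fix ev (t : tensor_term M N) : V := match t with
  | TTzero => 0 | TTadd t u => ev t + ev u | TTopp t => - ev t
  | TTpure m n => f m n end.
have evE t u : tensor_eq t u -> ev t = ev u.
  elim=> {t u} //=.
  - by move=> t u v _ -> _ ->.
  - by move=> t t' u u' _ -> _ ->.
  - by move=> t u _ ->.
  - by move=> *; rewrite addrA.
  - by move=> *; rewrite addrC.
  - by move=> *; rewrite add0r.
  - by move=> *; rewrite addNr.
have evc t : ev (repr (tclass t)) = ev t by apply/evE/trepr_eq.
exists (fun x => ev (repr x)); split; first split.
- move=> x; elim/tclassW: x => t x; elim/tclassW: x => u.
  by rewrite -tclassD !evc.
- by move=> m n; rewrite evc.
move=> h [hD hp]; apply/funext.
have h0 : h 0 = 0 by apply: (addrI (h 0)); rewrite -hD !addr0.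
move=> x; elim/tensor_ind: x => [|x y IHx IHy|x IHx|m n].
- by rewrite h0 (evc TTzero).
- rewrite hD -IHx -IHy; elim/tclassW: x {IHx} => t.
  by elim/tclassW: y {IHy} => u; rewrite -tclassD !evc.
- have -> : h (- x) = - h x by apply: (addrI (h x)); rewrite -hD !subrr h0.
  by rewrite -IHx; elim/tclassW: x {IHx} => t; rewrite -tclassN !evc.
- by rewrite evc hp.
Qed.

End TensorTheory.

Record morita_context (A B : rngType) : Type := MoritaContext {
  mc_M : bimodType A B;
  mc_N : bimodType B A;
  mc_psi : mc_M ⊗ mc_N -> regular A;
  mc_phi : mc_N ⊗ mc_M -> regular B;
  mc_psi_hom : bimod_hom mc_psi;
  mc_phi_hom : bimod_hom mc_phi;
  mc_assocN : forall (n' : mc_N) (m : mc_M) (n : mc_N),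
    n' <* mc_psi (m ⊗ₜ n) = mc_phi (n' ⊗ₜ m) *> n;
  mc_assocM : forall (m' : mc_M) (n : mc_N) (m : mc_M),
    m' <* mc_phi (n ⊗ₜ m) = mc_psi (m' ⊗ₜ n) *> m
}.

Arguments mc_psi {A B}.
Arguments mc_phi {A B}.

Definition surjective_context (A B : rngType) (X : morita_context A B) : Prop :=
  (forall a, exists x, mc_psi X x = a) /\ (forall b, exists y, mc_phi X y = b).

(******************************************************************************)
(* Not necessarily unital R-algebras presented by generators and relations:   *)
(* formal expressions in the generators modulo the least congruence that      *)
(* satisfies the algebra laws and contains the relations.  The universal      *)
(* property is presented_lift (and lpa_universal for Leavitt path algebras).  *)
(******************************************************************************)

Inductive alg_term (R X : Type) : Type :=
| Azero
| Aadd of alg_term R X & alg_term R X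
| Aopp of alg_term R X
| Ascale of R & alg_term R X
| Amul of alg_term R X & alg_term R X
| Agen of X.
Arguments Azero {R X}.
Arguments Agen {R X}.

HB.instance Definition _ (R X : Type) := gen_eqMixin (alg_term R X).
HB.instance Definition _ (R X : Type) := gen_choiceMixin (alg_term R X).

Fixpoint alg_eval (R : pzRingType) (X : Type) (B : rngAlgType R) (f : X -> B)
    (t : alg_term R X) : B :=
  match t with
  | Azero => 0
  | Aadd t u => alg_eval f t + alg_eval f u
  | Aopp t => - alg_eval f t
  | Ascale k t => k *: alg_eval f t
  | Amul t u => alg_eval f t ** alg_eval f u
  | Agen x => f x
  end.

Definition is_alg_hom (R : pzRingType) (A B : rngAlgType R) (f : A -> B) : Prop :=
  [/\ forall x y, f (x + y) = f x + f y,
      forall (k : R) x, f (k *: x) = k *: f x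
    & forall x y, f (x ** y) = f x ** f y].

Section PresentedAlgebra.
Context (R : comPzRingType) (X : Type).
Variable rels : alg_term R X -> alg_term R X -> Prop.
Implicit Types (k l : R) (t u v : alg_term R X).

Inductive alg_eq : alg_term R X -> alg_term R X -> Prop :=
| AErel t u : rels t u -> alg_eq t u
| AErefl t : alg_eq t t
| AEsym t u : alg_eq t u -> alg_eq u t
| AEtrans t u v : alg_eq t u -> alg_eq u v -> alg_eq t v
| AEadd t t' u u' : alg_eq t t' -> alg_eq u u' -> alg_eq (Aadd t u) (Aadd t' u')
| AEopp t t' : alg_eq t t' -> alg_eq (Aopp t) (Aopp t')
| AEscale k t t' : alg_eq t t' -> alg_eq (Ascale k t) (Ascale k t')
| AEmul t t' u u' : alg_eq t t' -> alg_eq u u' -> alg_eq (Amul t u) (Amul t' u')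
| AEaddA t u v : alg_eq (Aadd t (Aadd u v)) (Aadd (Aadd t u) v)
| AEaddC t u : alg_eq (Aadd t u) (Aadd u t)
| AEadd0 t : alg_eq (Aadd Azero t) t
| AEaddN t : alg_eq (Aadd (Aopp t) t) Azero
| AEscaleA k l t : alg_eq (Ascale k (Ascale l t)) (Ascale (k * l) t)
| AEscale1 t : alg_eq (Ascale 1 t) t
| AEscaleDr k t u :
    alg_eq (Ascale k (Aadd t u)) (Aadd (Ascale k t) (Ascale k u))
| AEscaleDl k l t :
    alg_eq (Ascale (k + l) t) (Aadd (Ascale k t) (Ascale l t))
| AEmulA t u v : alg_eq (Amul t (Amul u v)) (Amul (Amul t u) v)
| AEmulDl t u v : alg_eq (Amul (Aadd t u) v) (Aadd (Amul t v) (Amul u v))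
| AEmulDr t u v : alg_eq (Amul t (Aadd u v)) (Aadd (Amul t u) (Amul t v))
| AEscaleAl k t u : alg_eq (Ascale k (Amul t u)) (Amul (Ascale k t) u)
| AEscaleAr k t u : alg_eq (Ascale k (Amul t u)) (Amul t (Ascale k u)).

Definition alg_rel : rel (alg_term R X) := [rel t u | `[< alg_eq t u >]].

Fact alg_rel_refl : reflexive alg_rel.
Proof. by move=> t; apply/asboolP/AErefl. Qed.
Fact alg_rel_sym : symmetric alg_rel.
Proof. by move=> t u; apply/asboolP/asboolP; apply: AEsym. Qed.
Fact alg_rel_trans : transitive alg_rel.
Proof. by move=> u t v /asboolP tu /asboolP uv; apply/asboolP/(AEtrans tu). Qed.

Definition alg_equiv := EquivRel alg_rel alg_rel_refl alg_rel_sym alg_rel_trans.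

Definition presented : Type := {eq_quot alg_equiv}.
HB.instance Definition _ := Choice.on presented.
HB.instance Definition _ := EqQuotient.on presented.

Definition aclass t : presented := \pi_{eq_quot alg_equiv} t.

Lemma aclassP t u : aclass t = aclass u <-> alg_eq t u.
Proof. by split=> [/eqmodP/asboolP | h]; last by apply/eqmodP/asboolP. Qed.

Lemma aclassW (P : presented -> Prop) :
  (forall t, P (aclass t)) -> forall x, P x.
Proof. by move=> h x; rewrite -[x]reprK; apply: h. Qed.

Lemma arepr_eq t : alg_eq (repr (aclass t)) t.
Proof. by apply/aclassP; rewrite /aclass reprK. Qed.

Definition aadd (x y : presented) := aclass (Aadd (repr x) (repr y)).
Definition aopp (x : presented) := aclass (Aopp (repr x)).
Definition ascale (k : R) (x : presented) := aclass (Ascale k (repr x)).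
Definition amul (x y : presented) := aclass (Amul (repr x) (repr y)).

Lemma aaddE t u : aadd (aclass t) (aclass u) = aclass (Aadd t u).
Proof. by apply/aclassP/AEadd; apply: arepr_eq. Qed.
Lemma aoppE t : aopp (aclass t) = aclass (Aopp t).
Proof. by apply/aclassP/AEopp; apply: arepr_eq. Qed.
Lemma ascaleE k t : ascale k (aclass t) = aclass (Ascale k t).
Proof. by apply/aclassP/AEscale; apply: arepr_eq. Qed.
Lemma amulE t u : amul (aclass t) (aclass u) = aclass (Amul t u).
Proof. by apply/aclassP/AEmul; apply: arepr_eq. Qed.

Let aE := (aaddE, aoppE, ascaleE, amulE).

Fact aaddA : associative aadd.
Proof.
move=> x; elim/aclassW: x => t x; elim/aclassW: x => u x; elim/aclassW: x => v;
  rewrite !aE.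
exact/aclassP/AEaddA.
Qed.
Fact aaddC : commutative aadd.
Proof.
by move=> x; elim/aclassW: x => t x; elim/aclassW: x => u;
  rewrite !aE; apply/aclassP/AEaddC.
Qed.
Fact aadd0 : left_id (aclass Azero) aadd.
Proof. by move=> x; elim/aclassW: x => t;
  rewrite !aE; apply/aclassP/AEadd0. Qed.
Fact aaddN : left_inverse (aclass Azero) aopp aadd.
Proof. by move=> x; elim/aclassW: x => t;
  rewrite !aE; apply/aclassP/AEaddN. Qed.

HB.instance Definition _ :=
  GRing.isZmodule.Build presented aaddA aaddC aadd0 aaddN.

Fact ascaleA k l x : ascale k (ascale l x) = ascale (k * l) x.
Proof. by elim/aclassW: x => t; rewrite !aE; apply/aclassP/AEscaleA. Qed.
Fact ascale1 : left_id 1 ascale.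
Proof. by move=> x; elim/aclassW: x => t;
  rewrite !aE; apply/aclassP/AEscale1. Qed.
Fact ascaleDr : right_distributive ascale +%R.
Proof.
move=> k x; elim/aclassW: x => t x; elim/aclassW: x => u.
by rewrite /GRing.add /= !aE; apply/aclassP/AEscaleDr.
Qed.
Fact ascaleDl x : {morph ascale^~ x : k l / k + l}.
Proof.
elim/aclassW: x => t k l.
by rewrite [RHS]/GRing.add /= !aE; apply/aclassP/AEscaleDl.
Qed.

HB.instance Definition _ := GRing.Zmodule_isLmodule.Build R presented
  ascaleA ascale1 ascaleDr ascaleDl.

Fact amulA : associative amul.
Proof.
move=> x; elim/aclassW: x => t x; elim/aclassW: x => u x; elim/aclassW: x => v;
  rewrite !aE.
exact/aclassP/AEmulA.
Qed.
Fact amulDl : left_distributive amul +%R.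
Proof.
move=> x; elim/aclassW: x => t x; elim/aclassW: x => u x; elim/aclassW: x => v.
by rewrite /GRing.add /= !aE; apply/aclassP/AEmulDl.
Qed.
Fact amulDr : right_distributive amul +%R.
Proof.
move=> x; elim/aclassW: x => t x; elim/aclassW: x => u x; elim/aclassW: x => v.
by rewrite /GRing.add /= !aE; apply/aclassP/AEmulDr.
Qed.

HB.instance Definition _ := Zmodule_isRng.Build presented amulA amulDl amulDr.

Fact ascaleAl k (x y : presented) : k *: (x ** y) = (k *: x) ** y.
Proof.
elim/aclassW: x => t; elim/aclassW: y => u.
by rewrite /rmul /GRing.scale /= !aE; apply/aclassP/AEscaleAl.
Qed.
Fact ascaleAr k (x y : presented) : k *: (x ** y) = x ** (k *: y).
Proof.
elim/aclassW: x => t; elim/aclassW: y => u.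
by rewrite /rmul /GRing.scale /= !aE; apply/aclassP/AEscaleAr.
Qed.

HB.instance Definition _ := Rng_isRngAlg.Build R presented ascaleAl ascaleAr.

Definition agen (x : X) : presented := aclass (Agen x).

Lemma aclass_eval t : aclass t = alg_eval agen t.
Proof.
elim: t => //= [t IHt u IHu|t IHt|k t IHt|t IHt u IHu].
- by rewrite -IHt -IHu; exact: esym (aaddE t u).
- by rewrite -IHt; exact: esym (aoppE t).
- by rewrite -IHt; exact: esym (ascaleE k t).
- by rewrite -IHt -IHu; exact: esym (amulE t u).
Qed.

Lemma presented_rel t u : rels t u -> alg_eval agen t = alg_eval agen u.
Proof. by move=> h; rewrite -!aclass_eval; apply/aclassP/AErel. Qed.

Lemma is_alg_hom_eval (A B : rngAlgType R) (f : A -> B) (g : X -> A) t :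
  is_alg_hom f -> f (alg_eval g t) = alg_eval (f \o g) t.
Proof.
case=> fD fZ fM; have f0 : f 0 = 0.
  by apply: (addrI (f 0)); rewrite -fD !addr0.
elim: t => //= [t IHt u IHu|t IHt|k t IHt|t IHt u IHu].
- by rewrite fD IHt IHu.
- by apply: (addrI (f (alg_eval g t))); rewrite -fD subrr f0 IHt subrr.
- by rewrite fZ IHt.
- by rewrite fM IHt IHu.
Qed.

Lemma presented_lift (B : rngAlgType R) (f : X -> B) :
  (forall t u, rels t u -> alg_eval f t = alg_eval f u) ->
  exists! h : presented -> B, is_alg_hom h /\ forall x, h (agen x) = f x.
Proof.
move=> fR.
have evE t u : alg_eq t u -> alg_eval f t = alg_eval f u.
  elim=> {t u} //=.
  - by move=> t u v _ -> _ ->.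
  - by move=> t t' u u' _ -> _ ->.
  - by move=> t t' _ ->.
  - by move=> k t t' _ ->.
  - by move=> t t' u u' _ -> _ ->.
  - by move=> *; rewrite addrA.
  - by move=> *; rewrite addrC.
  - by move=> *; rewrite add0r.
  - by move=> *; rewrite addNr.
  - by move=> *; rewrite scalerA.
  - by move=> *; rewrite scale1r.
  - by move=> *; rewrite scalerDr.
  - by move=> *; rewrite scalerDl.
  - by move=> *; rewrite rmulA.
  - by move=> *; rewrite rmulDl.
  - by move=> *; rewrite rmulDr.
  - by move=> *; rewrite rscalerAl.
  - by move=> *; rewrite rscalerAr.
pose h (x : presented) := alg_eval f (repr x).
have hc t : h (aclass t) = alg_eval f t by apply/evE/arepr_eq.
exists h; split; first split; first split.
- move=> x; elim/aclassW: x => t x; elim/aclassW: x => u.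
  by rewrite {1}/GRing.add /= aaddE !hc.
- by move=> k x; elim/aclassW: x => t; rewrite {1}/GRing.scale /= ascaleE !hc.
- move=> x; elim/aclassW: x => t x; elim/aclassW: x => u.
  by rewrite {1}/rmul /= amulE !hc.
- by move=> x; rewrite hc.
move=> g [g_hom gf]; apply/funext; move=> x; elim/aclassW: x => t.
rewrite hc aclass_eval is_alg_hom_eval //.
by congr alg_eval; apply/funext => x /=; rewrite gf.
Qed.

End PresentedAlgebra.

(******************************************************************************)
(* Directed graphs follow the path convention in which e f is a path when     *)
(* s(e) = r(f); hence row-finiteness, sources and the second Cuntz-Krieger    *)
(* relation refer to r^{-1}(v).  A countType is the same as a countable set.  *)
(******************************************************************************)

Record digraph : Type := Digraph {
  vertex : countType;
  edge : countType;
  erange : edge -> vertex;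
  esource : edge -> vertex
}.
Arguments erange {d}.
Arguments esource {d}.

(* r^{-1}(v) *)
Definition edges_into (E : digraph) (v : vertex E) : set (edge E) :=
  [set e | erange e = v].

Definition row_finite (E : digraph) : Prop :=
  forall v : vertex E, finite_set (edges_into v).

Definition is_source (E : digraph) (v : vertex E) : bool :=
  `[< edges_into v = set0 >].

(* The pair (v, i) in the right summand encodes the head vertex v_{i+1},      *)
(* respectively the head edge f_{i+1}, attached to the source v; thus         *)
(* r(f_{i+1}) = v_i, with v_0 = v, and s(f_{i+1}) = v_{i+1}.                  *)
Section InfiniteHeads.
Variable E : digraph.

Definition graph_source : Type := {v : vertex E | is_source v}.
HB.instance Definition _ := Countable.on graph_source.

Definition head_rng (x : edge E + graph_source * nat) :
    vertex E + graph_source * nat :=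
  match x with
  | inl e => inl (erange e)
  | inr (v, 0%N) => inl (val v)
  | inr (v, i.+1) => inr (v, i)
  end.

Definition head_src (x : edge E + graph_source * nat) :
    vertex E + graph_source * nat :=
  match x with
  | inl e => inl (esource e)
  | inr (v, i) => inr (v, i)
  end.

Definition add_infinite_heads : digraph := Digraph head_rng head_src.
End InfiniteHeads.

Record leavitt_family (E : digraph) (A : rngType)
    (P : vertex E -> A) (S S' : edge E -> A) : Prop := LeavittFamily {
  lf_vertex : forall v w, P v ** P w = if v == w then P v else 0;
  lf_edgel : forall e, P (erange e) ** S e = S e;
  lf_edger : forall e, S e ** P (esource e) = S e;
  lf_ghostl : forall e, P (esource e) ** S' e = S' e;
  lf_ghostr : forall e, S' e ** P (erange e) = S' e;
  lf_ck1 : forall e f, S' e ** S f = if e == f then P (esource e) else 0;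
  lf_ck2 : forall v, finite_set (edges_into v) -> edges_into v !=set0 ->
    P v = \sum_(e \in edges_into v) (S e ** S' e)
}.

(* The generators P_v, S_e and S_{e^*}. *)
Inductive leavitt_gen (E : digraph) : Type :=
| Gvertex of vertex E
| Gedge of edge E
| Gghost of edge E.

Section LeavittPathAlgebra.
Context (R : comPzRingType) (E : digraph).

Local Notation term := (alg_term R (leavitt_gen E)).
Let P (v : vertex E) : term := Agen (Gvertex v).
Let S (e : edge E) : term := Agen (Gedge e).
Let S' (e : edge E) : term := Agen (Gghost e).

Inductive leavitt_rel : term -> term -> Prop :=
| LRvertex v w : leavitt_rel (Amul (P v) (P w)) (if v == w then P v else Azero)
| LRedgel e : leavitt_rel (Amul (P (erange e)) (S e)) (S e)
| LRedger e : leavitt_rel (Amul (S e) (P (esource e))) (S e)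
| LRghostl e : leavitt_rel (Amul (P (esource e)) (S' e)) (S' e)
| LRghostr e : leavitt_rel (Amul (S' e) (P (erange e))) (S' e)
| LRck1 e f :
    leavitt_rel (Amul (S' e) (S f)) (if e == f then P (esource e) else Azero)
| LRck2 v : finite_set (edges_into v) -> edges_into v !=set0 ->
    leavitt_rel (P v)
      (foldr (fun e t => Aadd (Amul (S e) (S' e)) t) Azero
         (fset_set (edges_into v))).

Definition leavitt_path_algebra : Type := presented leavitt_rel.
HB.instance Definition _ := RngAlg.on leavitt_path_algebra.

Definition lpaP (v : vertex E) : leavitt_path_algebra :=
  agen leavitt_rel (Gvertex v).
Definition lpaS (e : edge E) : leavitt_path_algebra :=
  agen leavitt_rel (Gedge e).
Definition lpaS' (e : edge E) : leavitt_path_algebra :=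
  agen leavitt_rel (Gghost e).

Let eval_ck2 (B : rngAlgType R) (f : leavitt_gen E -> B) (s : seq (edge E)) :
  alg_eval f (foldr (fun e t => Aadd (Amul (S e) (S' e)) t) Azero s) =
  \sum_(e <- s) (f (Gedge e) ** f (Gghost e)).
Proof. by elim: s => [|e s IHs] /=; rewrite ?big_nil // big_cons IHs. Qed.

Lemma lpa_family : leavitt_family lpaP lpaS lpaS'.
Proof.
split.
- by move=> v w; have := presented_rel (LRvertex v w); case: ifP.
- by move=> e; apply: presented_rel (LRedgel e).
- by move=> e; apply: presented_rel (LRedger e).
- by move=> e; apply: presented_rel (LRghostl e).
- by move=> e; apply: presented_rel (LRghostr e).
- by move=> e f; have := presented_rel (LRck1 e f); case: ifP.
- move=> v fin_v ne_v; have := presented_rel (LRck2 fin_v ne_v).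
  by rewrite eval_ck2 fsbig_finite.
Qed.

Lemma lpa_universal (B : rngAlgType R) (p : vertex E -> B) (s s' : edge E -> B) :
  leavitt_family p s s' ->
  exists! h : leavitt_path_algebra -> B, is_alg_hom h /\
    [/\ forall v, h (lpaP v) = p v, forall e, h (lpaS e) = s e
      & forall e, h (lpaS' e) = s' e].
Proof.
move=> fam.
pose f x := match x with
  | Gvertex v => p v | Gedge e => s e | Gghost e => s' e end.
have [|h [[h_hom hf] h_uniq]] := @presented_lift _ _ leavitt_rel B f.
  move=> t u; case=> /=.
  - by move=> v w; rewrite (lf_vertex fam); case: ifP.
  - exact: lf_edgel fam.
  - exact: lf_edger fam.
  - exact: lf_ghostl fam.
  - exact: lf_ghostr fam.
  - by move=> e e'; rewrite (lf_ck1 fam); case: ifP.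
  - move=> v fin_v ne_v; rewrite eval_ck2 (lf_ck2 fam) //.
    by rewrite fsbig_finite.
exists h; split.
  by split=> //; split=> x; apply: hf.
move=> g [g_hom [gP gS gS']]; apply: h_uniq; split=> //.
by case=> x; [apply: gP | apply: gS | apply: gS'].
Qed.

End LeavittPathAlgebra.

Notation "''L_' R ( E )" := (leavitt_path_algebra R E)
  (at level 8, R at level 2, format "''L_' R ( E )") : rng_scope.

(* Main.v *)
(* Write A = L(F), B = L(E) and let q_h = P_h for the head vertices h of F.  With
   p the formal sum of the P_v over the vertices v of E, the context consists of
   Ap and pA with multiplication as pairings; as p need not exist in A, these are
   described as the elements annihilated by every q_h, on the right for Ap and on
   the left for pA.  Two facts are needed.
   - The natural map B -> A is injective: A acts on the functions from {*} and
     the head vertices to B, each generator acting as a matrix unit with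
     coefficient in B, and b in B acts on the coordinate * by left
     multiplication, which is faithful because B has local units.  This replaces
     the graded uniqueness theorem.
   - Its image is pAp.  For a vertex x of F let beta_x be the path along the head
     from x down to a vertex of E.  Then beta_x^* beta_x = P_x, while
     beta_x beta_x^* is a vertex projection of E as every vertex on the way
     receives a single edge; so beta_x a beta_y^* lies in the image of B, by
     induction on a.
   Finally a = sum_x (a beta_x^* ) beta_x shows that Ap pA = A. *)
From HB Require Import structures.
Require Import Defs.
From mathcomp Require Import all_boot all_algebra finmap.
From mathcomp Require Import boolp classical_sets functions cardinality fsbigop.

Set Implicit Arguments.
Unset Strict Implicit.
Unset Printing Implicit Defensive.

Import GRing.Theory.
Local Open Scope ring_scope.
Local Open Scope classical_set_scope.
Local Open Scope rng_scope.

(** * Corners of rings without unit *)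

Section RngTheory.
Context (A : rngType).
Implicit Types x y : A.

Lemma rmul0l x : 0 ** x = 0.
Proof. by apply: (addrI (0 ** x)); rewrite -rmulDl !addr0. Qed.

Lemma rmul0r x : x ** 0 = 0.
Proof. by apply: (addrI (x ** 0)); rewrite -rmulDr !addr0. Qed.

Lemma rmulNl x y : (- x) ** y = - (x ** y).
Proof. by apply: (addrI (x ** y)); rewrite -rmulDl !subrr rmul0l. Qed.

Lemma rmulNr x y : x ** (- y) = - (x ** y).
Proof. by apply: (addrI (x ** y)); rewrite -rmulDr !subrr rmul0r. Qed.

Lemma rmul_suml (I : Type) (s : seq I) (F : I -> A) x :
  (\sum_(i <- s) F i) ** x = \sum_(i <- s) (F i ** x).
Proof.
apply: (big_morph (fun y => y ** x)) => [y z|]; [exact: rmulDl | exact: rmul0l].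
Qed.

Lemma rmul_sumr (I : Type) (s : seq I) (F : I -> A) x :
  x ** (\sum_(i <- s) F i) = \sum_(i <- s) (x ** F i).
Proof.
apply: (big_morph (fun y => x ** y)) => [y z|]; [exact: rmulDr | exact: rmul0r].
Qed.

End RngTheory.

(** The universal property supplies only an additive map. Both sides of each compatibility with an
    action are additive in the tensor, so pure tensors decide it. *)
Lemma tensor_bimod_lift (A B C : rngType) (M : bimodType A B)
    (N : bimodType B C) (V : bimodType A C) (f : M -> N -> V) :
  (forall m m' n, f (m + m') n = f m n + f m' n) ->
  (forall m n n', f m (n + n') = f m n + f m n') ->
  (forall m b n, f (m <* b) n = f m (b *> n)) ->
  (forall a m n, f (a *> m) n = a *> f m n) ->
  (forall m n c, f m (n <* c) = f m n <* c) ->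
  exists g : M ⊗ N -> V, bimod_hom g /\ forall m n, g (m ⊗ₜ n) = f m n.
Proof.
move=> fDl fDr fB fl fr.
have [g [[gD gp] _]] := tensor_lift fDl fDr fB.
(* Used for [g] and for the actions of a fixed scalar, since induction on tensors has separate cases
   for 0 and opposites. *)
have addhom (U W : zmodType) (h : U -> W) : {morph h : x y / x + y} ->
    h 0 = 0 /\ {morph h : x / - x}.
  move=> hD; have h0 : h 0 = 0 by apply: (addrI (h 0)); rewrite -hD !addr0.
  by split=> // x; apply: (addrI (h x)); rewrite -hD !subrr.
have [g0 gN] := addhom _ _ g gD.
exists g; split=> //; split=> // [a|x c].
- have [la0 laN] := addhom _ _ _ (@lactDr A B M a : {morph lact a : x y / x + y}).
  have [lt0 ltN] := addhom _ _ _ (@lactDr A C (M ⊗ N) a).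
  have [lv0 lvN] := addhom _ _ _ (@lactDr A C V a).
  elim/tensor_ind => [|x y IHx IHy|x IHx|m n].
  + by rewrite lt0 g0 lv0.
  + by rewrite lactDr !gD IHx IHy lactDr.
  + by rewrite ltN !gN IHx lvN.
  + by rewrite lact_pure !gp fl.
- have [lt0 ltN] := addhom _ _ (fun x => x <* c)
    (fun x y => @ractDl A C (M ⊗ N) x y c).
  have [lv0 lvN] := addhom _ _ (fun x => x <* c)
    (fun x y => @ractDl A C V x y c).
  elim/tensor_ind: x => [|x y IHx IHy|x IHx|m n].
  + by rewrite lt0 g0 lv0.
  + by rewrite ractDl !gD IHx IHy ractDl.
  + by rewrite ltN !gN IHx lvN.
  + by rewrite ract_pure !gp fr.
Qed.

(* [q] stands for the complementary idempotents: the last field says that [f] maps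
   onto the corner cut out by 1 - sum_j q_j, a sum that need not make sense. *)
Record corner_embedding (A B : rngType) (J : Type) (q : J -> A) (f : B -> A) :
  Prop := CornerEmbedding {
  ce_add : {morph f : x y / x + y};
  ce_mul : {morph f : x y / x ** y};
  ce_inj : injective f;
  ce_annl : forall j b, q j ** f b = 0;
  ce_annr : forall j b, f b ** q j = 0;
  ce_corner : forall x, (forall j, q j ** x = 0) -> (forall j, x ** q j = 0) ->
    exists b, f b = x
}.

(** * Columns, rows and the Morita context of a corner *)

Section CornerModules.
Context (A B : rngType) (J : Type) (q : J -> A) (f : B -> A).

Definition column_pred : {pred A} := fun x => `[< forall j, x ** q j = 0 >].
Definition row_pred : {pred A} := fun x => `[< forall j, q j ** x = 0 >].

Fact column_zmod_closed : zmod_closed column_pred.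
Proof.
split=> [|x y /asboolP xP /asboolP yP]; apply/asboolP => j.
  exact: rmul0l.
by rewrite rmulDl rmulNl xP yP subrr.
Qed.
HB.instance Definition _ := GRing.isZmodClosed.Build A column_pred
  column_zmod_closed.

Fact row_zmod_closed : zmod_closed row_pred.
Proof.
split=> [|x y /asboolP xP /asboolP yP]; apply/asboolP => j.
  exact: rmul0r.
by rewrite rmulDr rmulNr xP yP subrr.
Qed.
HB.instance Definition _ := GRing.isZmodClosed.Build A row_pred row_zmod_closed.

Context (ce : corner_embedding q f).

(* The hypothesis is an argument of the carriers because it provides their
   [B]-actions. *)
Definition column_module of corner_embedding q f : Type :=
  {x : A | x \in column_pred}.
Definition row_module of corner_embedding q f : Type :=
  {x : A | x \in row_pred}.
Local Notation M := (column_module ce).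
Local Notation N := (row_module ce).

HB.instance Definition _ := SubType.on M.
HB.instance Definition _ := Choice.on M.
HB.instance Definition _ := [SubChoice_isSubZmodule of M by <:].
HB.instance Definition _ := SubType.on N.
HB.instance Definition _ := Choice.on N.
HB.instance Definition _ := [SubChoice_isSubZmodule of N by <:].

Definition Column (x : A) (xP : forall j, x ** q j = 0) : M :=
  exist _ x (asboolT xP).
Definition Row (x : A) (xP : forall j, q j ** x = 0) : N :=
  exist _ x (asboolT xP).

Lemma columnP (m : M) j : val m ** q j = 0.
Proof. exact: (asboolW (valP m)). Qed.
Lemma rowP (n : N) j : q j ** val n = 0.
Proof. exact: (asboolW (valP n)). Qed.

Fact column_lact_subproof a (m : M) j : (a ** val m) ** q j = 0.
Proof. by rewrite -rmulA columnP rmul0r. Qed.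
Fact column_ract_subproof b (m : M) j : (val m ** f b) ** q j = 0.
Proof. by rewrite -rmulA (ce_annr ce) rmul0r. Qed.
Fact row_lact_subproof b (n : N) j : q j ** (f b ** val n) = 0.
Proof. by rewrite rmulA (ce_annl ce) rmul0l. Qed.
Fact row_ract_subproof a (n : N) j : q j ** (val n ** a) = 0.
Proof. by rewrite rmulA rowP rmul0l. Qed.

Definition column_lact a (m : M) : M := Column (column_lact_subproof a m).
Definition column_ract (m : M) b : M := Column (column_ract_subproof b m).
Definition row_lact b (n : N) : N := Row (row_lact_subproof b n).
Definition row_ract (n : N) a : N := Row (row_ract_subproof a n).

Fact column_lactA a a' m :
  column_lact a (column_lact a' m) = column_lact (a ** a') m.
Proof. by apply: val_inj => /=; rewrite rmulA. Qed.
Fact column_lactDl a a' m :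
  column_lact (a + a') m = column_lact a m + column_lact a' m.
Proof. by apply: val_inj => /=; rewrite rmulDl. Qed.
Fact column_lactDr a m m' :
  column_lact a (m + m') = column_lact a m + column_lact a m'.
Proof. by apply: val_inj => /=; rewrite rmulDr. Qed.
Fact column_ractA m b b' :
  column_ract (column_ract m b) b' = column_ract m (b ** b').
Proof. by apply: val_inj => /=; rewrite (ce_mul ce) rmulA. Qed.
Fact column_ractDl m m' b :
  column_ract (m + m') b = column_ract m b + column_ract m' b.
Proof. by apply: val_inj => /=; rewrite rmulDl. Qed.
Fact column_ractDr m b b' :
  column_ract m (b + b') = column_ract m b + column_ract m b'.
Proof. by apply: val_inj => /=; rewrite (ce_add ce) rmulDr. Qed.
Fact column_lractA a m b :
  column_ract (column_lact a m) b = column_lact a (column_ract m b).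
Proof. by apply: val_inj => /=; rewrite rmulA. Qed.

HB.instance Definition _ := Zmodule_isBimodule.Build A B M
  column_lactA column_lactDl column_lactDr
  column_ractA column_ractDl column_ractDr column_lractA.

Fact row_lactA b b' n : row_lact b (row_lact b' n) = row_lact (b ** b') n.
Proof. by apply: val_inj => /=; rewrite (ce_mul ce) rmulA. Qed.
Fact row_lactDl b b' n : row_lact (b + b') n = row_lact b n + row_lact b' n.
Proof. by apply: val_inj => /=; rewrite (ce_add ce) rmulDl. Qed.
Fact row_lactDr b n n' : row_lact b (n + n') = row_lact b n + row_lact b n'.
Proof. by apply: val_inj => /=; rewrite rmulDr. Qed.
Fact row_ractA n a a' : row_ract (row_ract n a) a' = row_ract n (a ** a').
Proof. by apply: val_inj => /=; rewrite rmulA. Qed.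
Fact row_ractDl n n' a : row_ract (n + n') a = row_ract n a + row_ract n' a.
Proof. by apply: val_inj => /=; rewrite rmulDl. Qed.
Fact row_ractDr n a a' : row_ract n (a + a') = row_ract n a + row_ract n a'.
Proof. by apply: val_inj => /=; rewrite rmulDr. Qed.
Fact row_lractA b n a :
  row_ract (row_lact b n) a = row_lact b (row_ract n a).
Proof. by apply: val_inj => /=; rewrite rmulA. Qed.

HB.instance Definition _ := Zmodule_isBimodule.Build B A N
  row_lactA row_lactDl row_lactDr row_ractA row_ractDl row_ractDr row_lractA.

(** The pairing into [A] is multiplication; the pairing into [B] is multiplication followed by the
    inverse of [f]. As [f] is injective, identities in [B] are checked in [A], where they are
    distributivity or associativity. The two spanning hypotheses give surjectivity. *)
Lemma corner_morita :
  (forall a, exists2 s : seq (A * A), a = \sum_(p <- s) (p.1 ** p.2) &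
    forall p, p \in s -> p.1 \in column_pred /\ p.2 \in row_pred) ->
  (forall b, exists s : seq (B * B), b = \sum_(p <- s) (p.1 ** p.2)) ->
  exists X : morita_context A B, surjective_context X.
Proof.
move=> spanA spanB.
(* A row times a column is annihilated by every [q j] on both sides, hence lies in the image of
   [f]. *)
have mulcorner (n : N) (m : M) : exists b, f b = val n ** val m.
  apply: (ce_corner ce) => j; first by rewrite rmulA rowP rmul0l.
  by rewrite -rmulA columnP rmul0r.
pose k n m : B := projT1 (cid (mulcorner n m)).
have kE n m : f (k n m) = val n ** val m by rewrite /k; case: cid.
have [|||||psi [psi_hom psiE]] := @tensor_bimod_lift A B A M N (regular A)
    (fun m n => val m ** val n).
- by move=> m m' n /=; rewrite rmulDl.
- by move=> m n n' /=; rewrite rmulDr.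
- by move=> m b n /=; rewrite rmulA.
- by move=> a m n /=; rewrite -rmulA.
- by move=> m n a /=; rewrite rmulA.
have [|||||phi [phi_hom phiE]] := @tensor_bimod_lift B A B N M (regular B) k.
- by move=> n n' m; apply: (ce_inj ce); rewrite (ce_add ce) !kE rmulDl.
- by move=> n m m'; apply: (ce_inj ce); rewrite (ce_add ce) !kE rmulDr.
- by move=> n a m; apply: (ce_inj ce); rewrite !kE /= rmulA.
- by move=> b n m; apply: (ce_inj ce); rewrite (ce_mul ce) !kE /= rmulA.
- by move=> n m b; apply: (ce_inj ce); rewrite (ce_mul ce) !kE /= rmulA.
have assocN (n' : N) (m : M) (n : N) :
    n' <* psi (m ⊗ₜ n) = phi (n' ⊗ₜ m) *> n.
  by apply: val_inj; rewrite psiE phiE /= kE rmulA.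
have assocM (m' : M) (n : N) (m : M) :
    m' <* phi (n ⊗ₜ m) = psi (m' ⊗ₜ n) *> m.
  by apply: val_inj; rewrite psiE phiE /= kE rmulA.
have hom0 (C D : rngType) (U V : bimodType C D) (h : U -> V) :
    bimod_hom h -> h 0 = 0.
  by case=> hD _ _; apply: (addrI (h 0)); rewrite -hD !addr0.
exists (MoritaContext psi_hom phi_hom assocN assocM); split=> /=.
- move=> a; have [s -> sP] := spanA a; elim: s sP => [|[x y] s IHs] sP.
    by exists 0; rewrite big_nil hom0.
  have [z zE] := IHs (fun p ps => sP p (mem_behead (s := _ :: _) ps)).
  have [xP yP] := sP (x, y) (mem_head _ _).
  exists ((exist _ x xP : M) ⊗ₜ (exist _ y yP : N) + z).
  by have [-> _ _] := psi_hom; rewrite big_cons zE psiE.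
- move=> b; have [s ->] := spanB b; elim: s => [|[x y] s [z zE]].
    by exists 0; rewrite big_nil hom0.
  (* Elements of [f B] are both rows and columns, and the pairing sends f(x) ⊗ f(y) to x y. *)
  exists ((Row ((ce_annl ce)^~ x)) ⊗ₜ (Column ((ce_annr ce)^~ y)) + z).
  have [-> _ _] := phi_hom; rewrite big_cons zE phiE; congr (_ + _).
  by apply: (ce_inj ce); rewrite (ce_mul ce) kE.
Qed.

End CornerModules.

(** * Local units *)

Section LeavittPathAlgebraTheory.
Context (R : comPzRingType) (G : digraph).
Local Notation L := ('L_R(G)).
Local Notation P := (lpaP R).
Local Notation S := (lpaS R).
Local Notation S' := (lpaS' R).
Local Notation LF := (lpa_family R G).

(** Opposites need no case of their own, because - x is (- 1) x. *)
Lemma lpa_ind (Q : L -> Prop) :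
  Q 0 -> (forall x y, Q x -> Q y -> Q (x + y)) ->
  (forall k x, Q x -> Q (k *: x)) ->
  (forall x y, Q x -> Q y -> Q (x ** y)) ->
  (forall v, Q (P v)) -> (forall e, Q (S e)) -> (forall e, Q (S' e)) ->
  forall x, Q x.
Proof.
move=> Q0 QD QZ QM QP QS QS' x; elim/aclassW: x => t; rewrite aclass_eval.
elim: t => //= [t IHt u IHu|t IHt|k t IHt|t IHt u IHu|[v|e|e]].
- exact: QD.
- by rewrite -scaleN1r; apply: QZ.
- exact: QZ.
- exact: QM.
- exact: QP.
- exact: QS.
- exact: QS'.
Qed.

Lemma lpa_hom_ext (B : rngAlgType R) (g h : L -> B) :
  is_alg_hom g -> is_alg_hom h -> (forall v, g (P v) = h (P v)) ->
  (forall e, g (S e) = h (S e)) -> (forall e, g (S' e) = h (S' e)) ->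
  forall x, g x = h x.
Proof.
move=> [gD gZ gM] [hD hZ hM] ghP ghS ghS'.
elim/lpa_ind=> // [|x y IHx IHy|k x IHx|x y IHx IHy].
- by rewrite -(scale0r 0) gZ hZ !scale0r.
- by rewrite gD hD IHx IHy.
- by rewrite gZ hZ IHx.
- by rewrite gM hM IHx IHy.
Qed.

Definition vertex_sum (s : {fset vertex G}) : L := \sum_(v <- s) P v.

Lemma lpaP_vertex_sum v (s : {fset vertex G}) :
  v \in s -> P v ** vertex_sum s = P v /\ vertex_sum s ** P v = P v.
Proof.
move=> vs; rewrite /vertex_sum rmul_sumr rmul_suml.
split; rewrite (bigD1_seq v) ?fset_uniq //= (lf_vertex LF) eqxx big1 ?addr0 //.
  by move=> w wv; rewrite (lf_vertex LF) eq_sym (negPf wv).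
by move=> w wv; rewrite (lf_vertex LF) (negPf wv).
Qed.

(** Each generator is fixed by the projections at its range and source. Asking for every [t] above
    [s] lets a union of two sets serve for sums and products. *)
Lemma lpa_local_unit (x : L) :
  exists s : {fset vertex G}, forall t : {fset vertex G}, (s `<=` t)%fset ->
    vertex_sum t ** x = x /\ x ** vertex_sum t = x.
Proof.
elim/lpa_ind: x => [|x y [s sP] [t tP]|k x [s sP]|x y [s sP] [t tP]|v|e|e].
- by exists fset0 => t _; rewrite rmul0l rmul0r.
- exists (s `|` t)%fset => u; rewrite fsubUset => /andP[/sP[xl xr] /tP[yl yr]].
  by rewrite rmulDl rmulDr xl xr yl yr.
- by exists s => t /sP[xl xr]; rewrite -rscalerAl -rscalerAr xl xr.
- exists (s `|` t)%fset => u; rewrite fsubUset => /andP[/sP[xl _] /tP[_ yr]].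
  by rewrite rmulA xl -rmulA yr.
- by exists [fset v]%fset => t; rewrite fsub1set => /lpaP_vertex_sum[].
- exists [fset erange e; esource e]%fset => t.
  rewrite fsubUset !fsub1set => /andP[/lpaP_vertex_sum[_ re]].
  move=> /lpaP_vertex_sum[se _].
  by rewrite -{1}(lf_edgel LF) rmulA re (lf_edgel LF) -(lf_edger LF) -rmulA se.
- exists [fset erange e; esource e]%fset => t.
  rewrite fsubUset !fsub1set => /andP[/lpaP_vertex_sum[re _]].
  move=> /lpaP_vertex_sum[_ se].
  by rewrite -{1}(lf_ghostl LF) rmulA se (lf_ghostl LF) -(lf_ghostr LF) -rmulA re.
Qed.

(** Stands in for multiplication by 1. *)
Lemma lpa_sumr (x : L) : exists s : {fset vertex G}, x = \sum_(v <- s) (x ** P v).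
Proof.
have [s sP] := lpa_local_unit x; exists s.
by rewrite -rmul_sumr; have [_ ->] := sP _ (fsubset_refl s).
Qed.

Lemma lpa_suml (x : L) : exists s : {fset vertex G}, x = \sum_(v <- s) (P v ** x).
Proof.
have [s sP] := lpa_local_unit x; exists s.
by rewrite -rmul_suml; have [-> _] := sP _ (fsubset_refl s).
Qed.

End LeavittPathAlgebraTheory.

(** * Matrix units as linear operators *)

Section LinearEndomorphisms.
Context (R : comPzRingType) (W : lmodType R).

Definition linear_pred : {pred W -> W} := fun f => `[< linear f >].

Fact linear_submod_closed : submod_closed linear_pred.
Proof.
split=> [|k f g /asboolP fL /asboolP gL]; apply/asboolP => l x y.
  by rewrite scaler0 addr0.
(* A multiple of a linear map is linear because [R] is commutative. *)
rewrite !fctE fL gL !scalerDr !scalerA [k * l]mulrC -!addrA.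
by congr (_ + _); rewrite addrCA.
Qed.
HB.instance Definition _ := GRing.isSubmodClosed.Build R (W -> W) linear_pred
  linear_submod_closed.

(** Made an algebra under composition, so that the universal property can produce
    representations. *)
Definition lin_end : Type := {f : W -> W | f \in linear_pred}.
HB.instance Definition _ := SubType.on lin_end.
HB.instance Definition _ := Choice.on lin_end.
HB.instance Definition _ := [SubChoice_isSubLmodule of lin_end by <:].

Definition LinEnd (f : W -> W) (fL : linear f) : lin_end :=
  exist _ f (asboolT fL).

Implicit Types f g h : lin_end.

Lemma lin_endP f : linear (val f).
Proof. exact: (asboolW (valP f)). Qed.

Lemma lin_endD f : {morph val f : x y / x + y}.
Proof. by move=> x y; have := lin_endP f 1 x y; rewrite !scale1r. Qed.

Lemma lin_endZ f (k : R) : {morph val f : x / k *: x}.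
Proof.
move=> x; have f0 : val f 0 = 0.
  by apply: (addrI (val f 0)); rewrite -lin_endD !addr0.
by have := lin_endP f k x 0; rewrite f0 !addr0.
Qed.

Fact comp_linear f g : linear (val f \o val g).
Proof. by move=> k x y /=; rewrite !lin_endP. Qed.

Definition lin_comp f g : lin_end := LinEnd (comp_linear f g).

Fact lin_compA : associative lin_comp.
Proof. by move=> f g h; apply: val_inj. Qed.
Fact lin_compDl : left_distributive lin_comp +%R.
Proof. by move=> f g h; apply: val_inj. Qed.
Fact lin_compDr : right_distributive lin_comp +%R.
Proof.
move=> f g h; apply: val_inj; apply/funext => x /=.
exact: lin_endD.
Qed.
HB.instance Definition _ := Zmodule_isRng.Build lin_end
  lin_compA lin_compDl lin_compDr.

Fact lin_compZl (k : R) f g : k *: (f ** g) = (k *: f) ** g.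
Proof. exact: val_inj. Qed.
Fact lin_compZr (k : R) f g : k *: (f ** g) = f ** (k *: g).
Proof.
apply: val_inj; apply/funext => x /=.
exact/esym/lin_endZ.
Qed.
HB.instance Definition _ := Rng_isRngAlg.Build R lin_end lin_compZl lin_compZr.

End LinearEndomorphisms.

Section MatrixUnits.
Context (R : comPzRingType) (B : rngAlgType R) (I : eqType).
Implicit Types (i j : I) (b c : B).

(** The matrix with single entry [c] at (i, j), acting on column vectors. Only one product is
    involved, so [I] may be infinite. *)
Definition munit_fun i j c (w : I -> B) : I -> B :=
  fun k => if k == i then c ** w j else 0.

Fact munit_linear i j c : linear (munit_fun i j c).
Proof.
move=> k x y; apply/funext => l; rewrite /munit_fun !fctE.
case: ifP => _; last by rewrite scaler0 addr0.
by rewrite rmulDr rscalerAr.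
Qed.

Definition munit i j c : lin_end (I -> B) :=
  LinEnd (@munit_linear i j c).

Lemma munitD i j : {morph munit i j : b c / b + c}.
Proof.
move=> b c; apply: val_inj; apply/funext => w; apply/funext => k /=.
by rewrite /munit_fun !fctE; case: ifP; rewrite ?addr0 // rmulDl.
Qed.

Lemma munitZ i j (k : R) c : munit i j (k *: c) = k *: munit i j c.
Proof.
apply: val_inj; apply/funext => w; apply/funext => l /=.
by rewrite /munit_fun !fctE; case: ifP; rewrite ?scaler0 // rscalerAl.
Qed.

Lemma munit0 i j : munit i j 0 = 0.
Proof. by rewrite -(scale0r 0) munitZ scale0r. Qed.

Lemma munitM i j k l b c :
  munit i j b ** munit k l c = if j == k then munit i l (b ** c) else 0.
Proof.
apply: val_inj; apply/funext => w; apply/funext => h /=.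
rewrite {1}/munit_fun /=; case: (eqVneq h i) => [->|hi].
  by rewrite /munit_fun; case: (j == k); rewrite /= /munit_fun ?eqxx ?rmulA ?rmul0r.
by case: (j == k) => //=; rewrite /munit_fun (negPf hi).
Qed.

(** The test vectors are the constant functions. Without a unit in [B] they show only that [c]
    annihilates [B] from the left; local units later give c = 0. *)
Lemma munit_eq0 i j c : munit i j c = 0 -> forall b, c ** b = 0.
Proof.
move=> c0 b; have := congr1 (fun f : lin_end (I -> B) => val f (fun=> b) i) c0.
by rewrite /= /munit_fun eqxx.
Qed.

Lemma munit_hom i : is_alg_hom (munit i i).
Proof. by split=> [||b c]; [exact: munitD | exact: munitZ | rewrite munitM eqxx]. Qed.

End MatrixUnits.

(** * Infinite heads *)

Section InfiniteHeadsTheory.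
Context (R : comPzRingType) (E : digraph).
Local Notation F := (add_infinite_heads E).
Local Notation B := ('L_R(E)).
Local Notation A := ('L_R(F)).
Local Notation P := (lpaP R).
Local Notation S := (lpaS R).
Local Notation S' := (lpaS' R).
Local Notation famE := (lpa_family R E).
Local Notation famF := (lpa_family R F).
Implicit Types (v w : vertex E) (e : edge E) (x y : vertex F) (g : edge F).

Lemma edges_into_regular v : ~~ is_source v ->
  edges_into (inl v : vertex F) = inl @` edges_into v.
Proof.
move=> vNs; apply/seteqP; split=> [[e|[u [|i]]] //= [uv]|_ [e <- <-]] //=.
  by exists e.
by move: vNs; rewrite -uv (valP u).
Qed.

Lemma edges_into_source (u : graph_source E) :
  edges_into (inl (val u) : vertex F) = [set inr (u, 0%N)].
Proof.
apply/seteqP; split=> [[e|[w [|i]]] //= [uv]|_ ->] //=; last first.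
  by rewrite (val_inj uv).
have /asboolP := valP u; rewrite -subset0 => /(_ e) []; exact: uv.
Qed.

Lemma edges_into_head (h : graph_source E * nat) :
  edges_into (inr h : vertex F) = [set inr (h.1, h.2.+1)].
Proof.
by case: h => u i; apply/seteqP; split=> [[e|[w [|j]]] //= [-> ->]|_ ->] //=.
Qed.

Lemma esource_regular e : ~~ is_source (erange e).
Proof.
by apply/negP => /asboolP; rewrite -subset0 => /(_ e); apply.
Qed.

(** Only the second Cuntz-Krieger relation needs an argument: a vertex receiving an edge of [E]
    carries no head, so it receives the same edges in [F]. *)
Lemma head_free_family :
  leavitt_family (fun v => P (inl v : vertex F)) (fun e => S (inl e : edge F))
    (fun e => S' (inl e : edge F)).
Proof.
split.
- by move=> v w; rewrite (lf_vertex famF).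
- by move=> e; exact: (lf_edgel famF (inl e)).
- by move=> e; exact: (lf_edger famF (inl e)).
- by move=> e; exact: (lf_ghostl famF (inl e)).
- by move=> e; exact: (lf_ghostr famF (inl e)).
- by move=> e f; rewrite (lf_ck1 famF).
- move=> v fin_v [e ev].
  have vNs : ~~ is_source v by rewrite -ev esource_regular.
  rewrite (lf_ck2 famF) edges_into_regular ?fsbig_image //.
  + by move=> ? ? _ _ [].
  + exact: finite_image.
  + by exists (inl e), e.
Qed.

Definition heads_emb : B -> A := sval (cid (lpa_universal head_free_family)).

Lemma heads_embP : is_alg_hom heads_emb /\
  [/\ forall v, heads_emb (P v) = P (inl v : vertex F),
      forall e, heads_emb (S e) = S (inl e : edge F)
    & forall e, heads_emb (S' e) = S' (inl e : edge F)].
Proof. by rewrite /heads_emb; case: cid => f []. Qed.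

(** * Representation of L_R(F) by matrix units over L_R(E) *)

Definition base x : vertex E :=
  match x with inl v => v | inr h => val h.1 end.
(** The coordinate on which the projection at [x] acts, with coefficient the projection at [base x].
    All vertices of [E] share the coordinate [None]; each head vertex has its own. *)
Definition head_index x : option (graph_source E * nat) :=
  match x with inl _ => None | inr h => Some h end.
(** Along a head every coefficient is the projection at the source where the head is attached, so
    head edges only shift this corner between coordinates. *)
Definition edge_coef g : B :=
  match g with inl e => S e | inr h => P (val h.1) end.
Definition ghost_coef g : B :=
  match g with inl e => S' e | inr h => P (val h.1) end.

Lemma lpaP_idem v : P v ** P v = P v.
Proof. by rewrite (lf_vertex famE) eqxx. Qed.

Lemma edge_coefl g : P (base (erange g)) ** edge_coef g = edge_coef g.
Proof.
by case: g => [e|[u [|i]]] /=; rewrite ?lpaP_idem // (lf_edgel famE).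
Qed.
Lemma edge_coefr g : edge_coef g ** P (base (esource g)) = edge_coef g.
Proof. by case: g => [e|[u i]] /=; rewrite ?lpaP_idem // (lf_edger famE). Qed.
Lemma ghost_coefl g : P (base (esource g)) ** ghost_coef g = ghost_coef g.
Proof. by case: g => [e|[u i]] /=; rewrite ?lpaP_idem // (lf_ghostl famE). Qed.
Lemma ghost_coefr g : ghost_coef g ** P (base (erange g)) = ghost_coef g.
Proof.
by case: g => [e|[u [|i]]] /=; rewrite ?lpaP_idem // (lf_ghostr famE).
Qed.

Lemma base_head_index x y :
  (x == y) = (head_index x == head_index y) && (base x == base y).
Proof.
apply/eqP/andP => [->|[/eqP + /eqP]]; first by rewrite !eqxx.
by case: x y => [v|h] [w|k] //= => [_ ->|[->]].
Qed.

Lemma edge_ne_source e (u : graph_source E) : erange e == val u = false.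
Proof.
by apply/negP => /eqP eu; have := esource_regular e; rewrite eu (valP u).
Qed.

(** If the coordinates differ, the matrix product vanishes anyway. If they agree, the delicate case
    is [None]: an edge of [E] and a first head edge are orthogonal since the range of the former is
    not a source, and two first head edges are compared by their sources. *)
Lemma coef_ck1 g g' : head_index (erange g) = head_index (erange g') ->
  ghost_coef g ** edge_coef g' = if g == g' then P (base (esource g)) else 0.
Proof.
case: g g' => [e|[u i]] [f|[w j]].
- by move=> _; exact: (lf_ck1 famE).
- case: j => //= _; rewrite -(lf_ghostr famE) -rmulA (lf_vertex famE).
  by rewrite edge_ne_source rmul0r.
- case: i => //= _; rewrite -(lf_edgel famE) rmulA (lf_vertex famE).
  by rewrite eq_sym edge_ne_source rmul0l.
- have uwE a : ((inr (u, a) : edge F) == inr (w, a)) = (u == w).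
    by apply/eqP/eqP => [[]|->].
  case: i j => [|i] [|j] //= => [_|[-> ->]].
  + by rewrite uwE (lf_vertex famE).
  + by rewrite lpaP_idem eqxx.
Qed.

Let V x := munit (head_index x) (head_index x) (P (base x)).
Let T g := munit (head_index (erange g)) (head_index (esource g)) (edge_coef g).
Let T' g :=
  munit (head_index (esource g)) (head_index (erange g)) (ghost_coef g).

(** Matching coordinates reduces each relation to one between coefficients. The second Cuntz-Krieger
    relation is trivial at head vertices and at sources of [E], which receive one edge each;
    elsewhere it is that of L_R(E). *)
Lemma matrix_family : leavitt_family V T T'.
Proof.
split.
- move=> x y; rewrite munitM (lf_vertex famE) base_head_index.
  by case: (eqVneq (head_index x)) => //= <-; case: eqP => // _; rewrite munit0.
- by move=> g; rewrite munitM eqxx edge_coefl.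
- by move=> g; rewrite munitM eqxx edge_coefr.
- by move=> g; rewrite munitM eqxx ghost_coefl.
- by move=> g; rewrite munitM eqxx ghost_coefr.
- move=> g g'; rewrite munitM; case: (eqVneq _ (head_index (erange g'))).
    by move=> /coef_ck1 ->; case: eqP => [->|_] //; rewrite munit0.
  by case: (eqVneq g g') => [->|//]; rewrite eqxx.
- move=> [v|h]; last first.
    move=> _ _; rewrite edges_into_head fsbig_set1 munitM eqxx /=.
    by rewrite lpaP_idem; case: h.
  have [vs|vNs] := boolP (is_source v).
    (* Presents [v] as an element of [graph_source E], so that its only incoming edge is the first
       edge of its head. *)
    rewrite -[v]/(val (exist (fun w => is_source w) v vs : graph_source E)).
    by move=> _ _; rewrite edges_into_source fsbig_set1 munitM eqxx /= lpaP_idem.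
  rewrite edges_into_regular // => fin_v [_ [e ev _]].
  have fin : finite_set (edges_into v).
    (* Finiteness passes back from [F] to [E] by injectivity of [inl]. *)
    by move: fin_v; rewrite (eq_finite_set (inj_card_eq _)) // => ? ? _ _ [].
  rewrite fsbig_image; last by move=> ? ? _ _ [].
  rewrite /V /= (lf_ck2 famE) //; last by exists e.
  rewrite !fsbig_finite // (big_morph _ (munitD _ _) (munit0 _ _ _)).
  apply: eq_big_seq => f /=; rewrite in_fset_set // inE => fv.
  by rewrite munitM eqxx.
Qed.

(** Followed by the matrix representation [th], the map becomes the ([None], [None]) matrix unit, as
    is seen on generators. *)
Lemma heads_emb_inj : injective heads_emb.
Proof.
have [[hD hZ hM] [hP hS hS']] := heads_embP.
have [th [[[tD tZ tM] [tP tS tS']] _]] := lpa_universal matrix_family.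
have thE b : th (heads_emb b) = munit None None b.
  move: b; apply: lpa_hom_ext.
  - by split=> *; rewrite ?hD ?hZ ?hM ?tD ?tZ ?tM.
  - exact: munit_hom.
  - by move=> v; rewrite hP tP.
  - by move=> e; rewrite hS tS.
  - by move=> e; rewrite hS' tS'.
have inj0 b : heads_emb b = 0 -> b = 0.
  (* Here b P_v = 0 for every [v], and [b] is a finite sum of such products. *)
  move=> hb; have [s ->] := lpa_sumr b; rewrite big1 // => v _.
  have th0 : th 0 = 0 by apply: (addrI (th 0)); rewrite -tD !addr0.
  by have := thE b; rewrite hb th0 => /esym/munit_eq0.
move=> b c bc; apply/eqP; rewrite -subr_eq0; apply/eqP/inj0.
by rewrite hD bc -hD subrr -(scale0r 0) hZ scale0r.
Qed.

(** * Paths along the heads *)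

(* The path f_1 ... f_{i+1} from the head vertex [inr (u, i)] to the source [u]. *)
Fixpoint head_path (u : graph_source E) (i : nat) : A :=
  if i is j.+1 then head_path u j ** S (inr (u, i) : edge F)
  else S (inr (u, 0%N) : edge F).
Fixpoint head_ghost_path (u : graph_source E) (i : nat) : A :=
  if i is j.+1 then S' (inr (u, i) : edge F) ** head_ghost_path u j
  else S' (inr (u, 0%N) : edge F).

(** This is beta_x, and [from_base x] is its ghost beta_x^*; at a vertex of [E] the path has length
    zero. *)
Definition to_base x : A :=
  match x with inl v => P x | inr (u, i) => head_path u i end.
Definition from_base x : A :=
  match x with inl v => P x | inr (u, i) => head_ghost_path u i end.
Local Notation P0 x := (P (inl (base x) : vertex F)).

Lemma lpaP_idemF x : P x ** P x = P x.
Proof. by rewrite (lf_vertex famF) eqxx. Qed.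

Lemma edge_ck2 x g : edges_into x = [set g] -> P x = S g ** S' g.
Proof.
by move=> xg; rewrite (lf_ck2 famF) xg ?fsbig_set1 //; exists g.
Qed.

Lemma to_baser x : to_base x ** P x = to_base x.
Proof.
case: x => [v|[u [|i]]] /=; first exact: lpaP_idemF.
  exact: (lf_edger famF (inr (u, 0%N))).
by rewrite -rmulA (lf_edger famF (inr (u, i.+1))).
Qed.

Lemma from_basel x : P x ** from_base x = from_base x.
Proof.
case: x => [v|[u [|i]]] /=; first exact: lpaP_idemF.
  exact: (lf_ghostl famF (inr (u, 0%N))).
by rewrite rmulA (lf_ghostl famF (inr (u, i.+1))).
Qed.

Lemma to_basel x : P0 x ** to_base x = to_base x.
Proof.
case: x => [v|[u i]] /=; first exact: lpaP_idemF.
elim: i => [|i IHi] /=; first exact: (lf_edgel famF (inr (u, 0%N))).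
by rewrite rmulA IHi.
Qed.

Lemma from_baser x : from_base x ** P0 x = from_base x.
Proof.
case: x => [v|[u i]] /=; first exact: lpaP_idemF.
elim: i => [|i IHi] /=; first exact: (lf_ghostr famF (inr (u, 0%N))).
by rewrite -rmulA IHi.
Qed.

(** The product collapses from the middle by the first Cuntz-Krieger relation. *)
Lemma from_base_to_base x : from_base x ** to_base x = P x.
Proof.
case: x => [v|[u i]] /=; first exact: lpaP_idemF.
elim: i => [|i IHi] /=; first by rewrite (lf_ck1 famF) eqxx.
rewrite -rmulA (rmulA (head_ghost_path u i)) IHi.
by rewrite (lf_edgel famF (inr (u, i.+1))) (lf_ck1 famF) eqxx.
Qed.

(** The innermost S_g S_g^* is a vertex projection by the second Cuntz-Krieger relation, as each
    vertex passed receives only the edge [g]. *)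
Lemma to_base_from_base x : to_base x ** from_base x = P0 x.
Proof.
case: x => [v|[u i]] /=; first exact: lpaP_idemF.
elim: i => [|i IHi] /=; first by rewrite (edge_ck2 (edges_into_source u)).
rewrite -rmulA (rmulA (S _)) -(edge_ck2 (edges_into_head (u, i))).
by rewrite (from_basel (inr (u, i))) IHi.
Qed.

(** A head edge extends the path of its range to that of its source, leaving beta beta^*; for an
    edge of [E] both paths are trivial. *)
Lemma base_edge g :
  to_base (erange g) ** S g ** from_base (esource g) = heads_emb (edge_coef g).
Proof.
have [_ [hP hS _]] := heads_embP.
case: g => [e|[u i]] /=.
  by rewrite (lf_edgel famF (inl e)) (lf_edger famF (inl e)) hS.
rewrite hP -(to_base_from_base (inr (u, i))); congr (_ ** _).
case: i => [|i] //=; exact: (lf_edgel famF (inr (u, 0%N))).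
Qed.

Lemma base_ghost g :
  to_base (esource g) ** S' g ** from_base (erange g) =
  heads_emb (ghost_coef g).
Proof.
have [_ [hP _ hS']] := heads_embP.
case: g => [e|[u i]] /=.
  by rewrite (lf_ghostl famF (inl e)) (lf_ghostr famF (inl e)) hS'.
rewrite hP -(to_base_from_base (inr (u, i))) -rmulA; congr (_ ** _).
case: i => [|i] //=; exact: (lf_ghostr famF (inr (u, 0%N))).
Qed.

(** * The image of L_R(E) as a corner of L_R(F) *)

Lemma heads_emb0 : heads_emb 0 = 0.
Proof. by have [[_ hZ _] _] := heads_embP; rewrite -(scale0r 0) hZ scale0r. Qed.

Lemma heads_emb_sum (I : Type) (s : seq I) (f : I -> A) :
  (forall i, exists b, heads_emb b = f i) ->
  exists b, heads_emb b = \sum_(i <- s) f i.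
Proof.
have [[hD _ _] _] := heads_embP => fP.
elim: s => [|i s [c hc]]; first by exists 0; rewrite big_nil heads_emb0.
by have [b hb] := fP i; exists (b + c); rewrite big_cons hD hb hc.
Qed.

Lemma to_base_lpaP x y : to_base x ** P y = if x == y then to_base x else 0.
Proof.
rewrite -{1}to_baser -rmulA (lf_vertex famF).
by case: eqP; rewrite ?to_baser ?rmul0r.
Qed.

Lemma lpaP_from_base x y : P x ** from_base y = if x == y then from_base y else 0.
Proof.
rewrite -{1}from_basel rmulA (lf_vertex famF).
by case: eqP => [->|_]; rewrite ?from_basel ?rmul0l.
Qed.

(** Induction on [a] for all [x] and [y] at once, because products bring in intermediate
    vertices. *)
Lemma base_conj_emb (a : A) x y :
  exists b, heads_emb b = to_base x ** a ** from_base y.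
Proof.
have [[hD hZ hM] [hP _ _]] := heads_embP.
elim/lpa_ind: a x y => [|a b IHa IHb|k a IHa|a b IHa IHb|v|g|g] x y.
- by exists 0; rewrite heads_emb0 rmul0r rmul0l.
- have [[a' ha] [b' hb]] := (IHa x y, IHb x y).
  by exists (a' + b'); rewrite hD ha hb rmulDr rmulDl.
- have [a' ha] := IHa x y.
  by exists (k *: a'); rewrite hZ ha -rscalerAr -rscalerAl.
(* Between the two factors a sum of P_z is inserted and each P_z is replaced by beta_z^* beta_z. *)
- have [s ->] := lpa_suml b; rewrite !rmul_sumr rmul_suml.
  apply: heads_emb_sum => z; have [[a' ha] [b' hb]] := (IHa x z, IHb z y).
  by exists (a' ** b'); rewrite hM ha hb -from_base_to_base !rmulA.
- rewrite to_base_lpaP; case: eqP => _; last first.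
    by exists 0; rewrite heads_emb0 rmul0l.
  rewrite -from_basel rmulA to_base_lpaP; case: eqP => [->|_]; last first.
    by exists 0; rewrite heads_emb0 rmul0l.
  by rewrite to_base_from_base -hP; eexists.
(* With the range and source projections written out, the product vanishes unless [x] is the range
   and [y] the source of [g]. *)
- rewrite -(lf_edgel famF) -(lf_edger famF) !rmulA to_base_lpaP.
  case: eqP => [->|_]; last by exists 0; rewrite heads_emb0 !rmul0l.
  rewrite -rmulA lpaP_from_base; case: eqP => [<-|_]; last first.
    by exists 0; rewrite heads_emb0 rmul0r.
  by rewrite base_edge; eexists.
- rewrite -(lf_ghostl famF) -(lf_ghostr famF) !rmulA to_base_lpaP.
  case: eqP => [->|_]; last by exists 0; rewrite heads_emb0 !rmul0l.
  rewrite -rmulA lpaP_from_base; case: eqP => [<-|_]; last first.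
    by exists 0; rewrite heads_emb0 rmul0r.
  by rewrite base_ghost; eexists.
Qed.

Lemma heads_corner_embedding :
  corner_embedding (fun h => P (inr h : vertex F)) heads_emb.
Proof.
have [[hD hZ hM] [hP _ _]] := heads_embP.
split=> // [|h b|h b|a al ar].
- exact: heads_emb_inj.
- have [s ->] := lpa_suml b; rewrite (big_morph _ hD heads_emb0) rmul_sumr.
  by rewrite big1 // => v _; rewrite hM hP rmulA (lf_vertex famF) rmul0l.
- have [s ->] := lpa_sumr b; rewrite (big_morph _ hD heads_emb0) rmul_suml.
  by rewrite big1 // => v _; rewrite hM hP -rmulA (lf_vertex famF) rmul0r.
- have [s ->] := lpa_suml a; apply: heads_emb_sum => -[v|h]; last first.
    by exists 0; rewrite al heads_emb0.
  have [t ->] := lpa_sumr a; rewrite rmul_sumr; apply: heads_emb_sum.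
  move=> [w|h]; last by exists 0; rewrite ar rmul0r heads_emb0.
  by have [b hb] := base_conj_emb a (inl v) (inl w); exists b; rewrite hb rmulA.
Qed.

Lemma lpa_column_row (a : A) : exists2 s : seq (A * A),
  a = \sum_(p <- s) (p.1 ** p.2) & forall p, p \in s ->
    p.1 \in column_pred (fun h => P (inr h : vertex F)) /\
    p.2 \in row_pred (fun h => P (inr h : vertex F)).
Proof.
have [s aE] := lpa_sumr a.
exists [seq (a ** from_base x, to_base x) | x <- s].
  rewrite {1}aE big_map; apply: eq_bigr => x _ /=.
  by rewrite -rmulA from_base_to_base.
move=> _ /mapP[x _ ->]; split; apply/asboolP => h /=.
  by rewrite -from_baser -!rmulA (lf_vertex famF) !rmul0r.
by rewrite -to_basel rmulA (lf_vertex famF) rmul0l.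
Qed.

End InfiniteHeadsTheory.

Theorem corollary7p6 (R : comPzRingType) (E : digraph) :
  row_finite E ->
  exists X : morita_context 'L_R(add_infinite_heads E) 'L_R(E),
    surjective_context X.
Proof.
move=> _; apply: (corner_morita (heads_corner_embedding R E)).
  exact: lpa_column_row.
move=> b; have [s ->] := lpa_sumr b.
exists [seq (b ** lpaP R v, lpaP R v) | v <- s]; rewrite big_map.
by apply: eq_bigr => v _ /=; rewrite -rmulA (lf_vertex (lpa_family R E)) eqxx.
Qed.
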